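(* Let $(x,\hat y)$ be a data point with $\hat y\in\mathbb{R}^K$, and let $f(w)=\frac1K\|n_x(w)-\hat y\|_2^2$ be the MSE loss for the output $n_x(w)\in\mathbb{R}^K$ of a network (with the identity applied after the network). Assume that the last layer is linear, i.e. $n_x(w)=W\,x'(w')+b$, where $W\in\mathbb{R}^{K\times p}$, $b\in\mathbb{R}^K$, $w'$ denotes all parameters in $w$ other than $W$ and $b$, and $x'=x'(w')\in\mathbb{R}^p$ is the output of the previous layer on input $x$. Then the following are true: 1. The sub-Hessian of $f$ with respect to the weights of the last layer has the form $$\nabla_W^2 f(w)=\frac2K I_K\otimes x'x'^T,\qquad \nabla_b^2 f(w)=\frac2K I_K,\qquad \nabla^2_{W,b}f(w)=\frac2K I_K\otimes x'.$$ 2. The trace of this sub-Hessian is $\operatorname{trace}\big(\nabla^2_{(W,b)}f(w)\big)=2(\|x'\|^2+1)$. 3. The biggest eigenvalue of the Hessian is at least $\frac2K$, i.e. $\lambda_1(\nabla_w^2 f(w))\ge\frac2K$.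
   Context: $K$ is the number of classes and $p$ the output dimension of the second-to-last layer; $w=(w',W,b)$ collects all parameters of the network. $W$ is vectorized by stacking its rows, so that $\nabla_W^2f$ is a $Kp\times Kp$ matrix and the mixed block $\nabla^2_{W,b}f$ is $Kp\times K$; $\otimes$ is the Kronecker product, $I_K$ the $K\times K$ identity matrix, $x'$ a column vector, $\|\cdot\|$ the Euclidean norm. $\nabla^2_{(W,b)}f$ is the Hessian with respect to the joint variable $(W,b)$, and $\nabla_w^2 f$ the Hessian with respect to all parameters. In item 3, $\lambda_1$ denotes the biggest eigenvalue. *)

(* Defs.v *)
From mathcomp Require Import all_boot all_order all_algebra.
From mathcomp Require Import all_classical all_reals all_analysis.
From mathcomp Require Import mxtens.

Set Implicit Arguments.
Unset Strict Implicit.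
Unset Printing Implicit Defensive.

Import Order.TTheory GRing.Theory Num.Theory numFieldNormedType.Exports.

Local Open Scope classical_set_scope.
Local Open Scope ring_scope.

(* The library norm on matrices is the sup norm, hence this definition. *)
Definition euclidean_norm (R : realType) (n : nat) (v : 'cV[R]_n) : R :=
  Num.sqrt (\sum_i v i 0 ^+ 2).

Definition mse_loss (R : realType) (K : nat) (out yhat : 'cV[R]_K) : R :=
  K%:R^-1 * euclidean_norm (out - yhat) ^+ 2.

(* Entry (i, j) is the second partial derivative d/dx_i (d/dx_j f) at a.
   'D_v is total; the value is meaningful when f is twice differentiable. *)
Definition hessian (R : realType) (n : nat) (f : 'rV[R]_n -> R)
    (a : 'rV[R]_n) : 'M[R]_n :=
  \matrix_(i, j) 'D_(delta_mx 0 i) (fun v => 'D_(delta_mx 0 j) f v) a.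

(* Frechet sense: f is differentiable near a, and its gradient at a. *)
Definition twice_differentiable (R : realType) (n : nat) (f : 'rV[R]_n -> R)
    (a : 'rV[R]_n) : Prop :=
  (\forall v \near a, differentiable f v) /\
  (forall j, differentiable (fun v => 'D_(delta_mx 0 j) f v) a).

Definition largest_eigenvalue (R : realType) (n : nat) (A : 'M[R]_n) (l : R) :
    Prop :=
  eigenvalue A l /\ (forall m, eigenvalue A m -> m <= l).

(* The parameter vector w = (w', W, b); mxvec lists the rows of W one after
   the other. *)
Definition params (R : realType) (m K p : nat) (w' : 'rV[R]_m)
    (W : 'M[R]_(K, p)) (b : 'cV[R]_K) : 'rV[R]_(m + (K * p + K)) :=
  row_mx w' (row_mx (mxvec W) b^T).

(* f as a function of (W, b) only, the other parameters being those of w. *)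
Definition last_layer (R : realType) (m K p : nat)
    (f : 'rV[R]_(m + (K * p + K)) -> R) (w : 'rV[R]_(m + (K * p + K))) :
    'rV[R]_(K * p + K) -> R :=
  fun t => f (row_mx (lsubmx w) t).

Definition hessian_Wb (R : realType) (m K p : nat)
    (f : 'rV[R]_(m + (K * p + K)) -> R) (w : 'rV[R]_(m + (K * p + K))) :
    'M[R]_(K * p + K) :=
  hessian (last_layer f w) (rsubmx w).

Definition hessian_W (R : realType) (m K p : nat)
    (f : 'rV[R]_(m + (K * p + K)) -> R) (w : 'rV[R]_(m + (K * p + K))) :
    'M[R]_(K * p) :=
  ulsubmx (hessian_Wb f w).

Definition hessian_W_b (R : realType) (m K p : nat)
    (f : 'rV[R]_(m + (K * p + K)) -> R) (w : 'rV[R]_(m + (K * p + K))) :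
    'M[R]_(K * p, K) :=
  ursubmx (hessian_Wb f w).

Definition hessian_b (R : realType) (m K p : nat)
    (f : 'rV[R]_(m + (K * p + K)) -> R) (w : 'rV[R]_(m + (K * p + K))) :
    'M[R]_K :=
  drsubmx (hessian_Wb f w).

(* Main.v *)
(* (W, b) |-> n_x(w) is affine with linear part M^T, where M stacks I_K (x) x' over
   I_K, so the Hessian in (W, b) is (2/K) M M^T, whose blocks are read off.  The
   entry of the full Hessian at a bias coordinate is therefore 2/K.  The full
   Hessian is symmetric (Young: f is differentiable near w and its partial
   derivatives are differentiable at w), so its largest eigenvalue is the maximum
   of its quadratic form on the unit sphere, which is at least any diagonal
   entry. *)
Require Import Defs.
From mathcomp Require Import all_boot all_order all_algebra.
From mathcomp Require Import all_classical all_reals all_analysis.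
From mathcomp Require Import mxtens ring lra.

Set Implicit Arguments.
Unset Strict Implicit.
Unset Printing Implicit Defensive.

Import Order.TTheory GRing.Theory Num.Theory numFieldNormedType.Exports.
Local Open Scope ring_scope.
Local Open Scope classical_set_scope.

(** * Symmetry of second derivatives *)

(** The two difference quotients coincide. This reduces directional derivatives to derivatives in
    one real variable, as the mean value theorem requires. *)
Lemma derivable_line (R : realType) (V : normedModType R) (f : V -> R) (b u : V)
    (s : R) :
  derivable f (s *: u + b) u ->
  is_derive s 1 (fun r => f (r *: u + b)) ('D_u f (s *: u + b)).
Proof.
move=> df.
have E : (fun h : R => h^-1 *: (((fun r : R => f (r *: u + b)) \o shift s) (h *: 1)
      - f (s *: u + b))) =
    (fun h : R => h^-1 *: ((f \o shift (s *: u + b)) (h *: u) - f (s *: u + b))).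
  by apply/funext => h /=; rewrite [h *: 1]mulr1 scalerDl addrA.
by split; rewrite /derivable /derive E.
Qed.

Lemma differentiable_approx (R : realType) (V : normedModType R) (g : V -> R)
    (a : V) (e : R) :
  differentiable g a -> 0 < e ->
  \forall h \near 0, `|g (h + a) - g a - 'd g a h| <= e * `|h|.
Proof.
move=> /diff_locally /eqaddoP dg e0.
have := dg e e0; apply: filter_app; near=> h.
by rewrite /= opprD addrA.
Unshelve. all: by end_near. Qed.

Lemma near0_normP (R : realType) (V : normedModType R) (P : V -> Prop) :
  (\forall h \near 0, P h) -> exists2 d : R, 0 < d & forall h, `|h| < d -> P h.
Proof.
move=> /nbhs_normP[d d0 dP]; exists d => // h hd.
by apply: dP; rewrite /= sub0r normrN.
Qed.

(* Mean value theorem in the direction u, applied to the increment of f in the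
   direction v. *)
Lemma second_difference_approx (R : realType) (V : normedModType R) (f : V -> R)
    (a u v : V) (e : R) :
  (\forall x \near a, differentiable f x) -> differentiable ('D_u f) a ->
  0 < e ->
  exists2 d : R, 0 < d & forall t, 0 < t < d ->
    `|f (t *: u + (t *: v + a)) - f (t *: u + a) - f (t *: v + a) + f a
      - t ^+ 2 * 'D_v ('D_u f) a| <= e * t ^+ 2.
Proof.
move=> fnear dg e0; set g := 'D_u f.
(* The summand 1 keeps [C] positive when [u] and [v] vanish. For [0 <= s <= t], the displacements
   [s *: u] and [s *: u + t *: v] have norm at most [t * C]. *)
pose C := `|u| + `|v| + 1.
have C0 : 0 < C by rewrite /C ltr_wpDl// addr_ge0.
(* Two linearization errors of [g] will occur, each at a displacement of norm at most [t * C]; this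
   rate makes each of them at most [e * t / 2]. *)
have e'0 : 0 < e / (2 * C) by rewrite divr_gt0// mulr_gt0.
have /near0_normP[d1 d10 near1] := differentiable_approx dg e'0.
have /near0_normP[d2 d20 near2] :
    \forall h \near 0, differentiable f (h + a).
  by move: fnear; rewrite (near_shift 0) subr0.
exists (Num.min d1 d2 / C) => [|t /andP[t0]].
  by rewrite divr_gt0// lt_min d10.
rewrite ltr_pdivlMr// lt_min => /andP[tC1 tC2].
have step s : 0 <= s <= t ->
    `|s *: u| <= t * C /\ `|s *: u + t *: v| <= t * C.
  move=> /andP[s0 st].
  have su : `|s *: u| <= t * `|u| by rewrite normrZ ger0_norm// ler_wpM2r.
  have tv : `|t *: v| = t * `|v| by rewrite normrZ ger0_norm// ltW.
  have sutv := ler_normD (s *: u) (t *: v).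
  have u0 := normr_ge0 u; have v0 := normr_ge0 v.
  by split; rewrite /C; nra.
(* The second difference is [phi t - phi 0], so the mean value theorem turns it into [t] times an
   increment of [g] along [t *: v]. *)
pose phi s := f (s *: u + (t *: v + a)) - f (s *: u + a).
have dphi s : 0 <= s <= t ->
    is_derive s 1 phi (g (s *: u + (t *: v + a)) - g (s *: u + a)).
  move=> /step[n1 n2]; apply: is_deriveB; apply: derivable_line;
    apply: diff_derivable; rewrite ?addrA; apply: near2;
    by apply: le_lt_trans tC2.
have [||s] := @MVT R phi
    (fun s => g (s *: u + (t *: v + a)) - g (s *: u + a)) 0 t t0.
- by move=> s; rewrite in_itv/= => /andP[s0 st]; apply: dphi; rewrite !ltW.
- apply: derivable_within_continuous => s; rewrite in_itv/= => sI.
  by have [] := dphi s sI.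
rewrite in_itv/= => /andP[s0 st]; rewrite subr0 => phiE.
have [n1 n2] : `|s *: u| <= t * C /\ `|s *: u + t *: v| <= t * C.
  by apply: step; rewrite !ltW.
have E1 := near1 _ (le_lt_trans n1 tC1).
have E2 := near1 _ (le_lt_trans n2 tC1).
have -> : 'D_v g a = 'd g a v by rewrite deriveE.
have -> : f (t *: u + (t *: v + a)) - f (t *: u + a) - f (t *: v + a) + f a =
    phi t - phi 0 by rewrite /phi scale0r !add0r; ring.
rewrite phiE.
(* The values [g a] cancel, and by linearity the two differentials differ by [t * 'd g a v], which
   is the main term. *)
have -> : (g (s *: u + (t *: v + a)) - g (s *: u + a)) * t - t ^+ 2 * 'd g a v =
   t * ((g (s *: u + t *: v + a) - g a - 'd g a (s *: u + t *: v)) -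
    (g (s *: u + a) - g a - 'd g a (s *: u))).
  have -> : 'd g a (s *: u + t *: v) = 'd g a (s *: u) + t * 'd g a v.
    by rewrite linearD [X in _ + X]linearZ.
  by rewrite addrA; ring.
rewrite normrM (gtr0_norm t0) expr2 mulrA [e * t]mulrC -mulrA.
rewrite ler_pM2l//.
apply: (le_trans (ler_normB _ _)).
have bound x : x <= t * C -> e / (2 * C) * x <= e * t / 2.
  move=> xC; apply: (le_trans (ler_wpM2l (ltW e'0) xC)).
  by rewrite le_eqVlt; apply/orP; left; apply/eqP; field; exact: lt0r_neq0.
have := bound _ n1; have := bound _ n2; lra.
Qed.

(** The second difference is symmetric in [u] and [v], so both mixed derivatives, multiplied by
    [t ^+ 2], lie within [e / 2 * t ^+ 2] of it for small [t]. Hence they differ by at most [e], for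
    every [e > 0]. *)
Lemma derive_comm (R : realType) (V : normedModType R) (f : V -> R) (a u v : V) :
  (\forall x \near a, differentiable f x) ->
  differentiable ('D_u f) a -> differentiable ('D_v f) a ->
  'D_u ('D_v f) a = 'D_v ('D_u f) a.
Proof.
have close (e D A B q : R) : `|D - q * A| <= e / 2 * q ->
    `|D - q * B| <= e / 2 * q -> `|(B - A) * q| <= e * q.
  rewrite ler_norml => /andP[? ?]; rewrite ler_norml => /andP[? ?].
  by rewrite ler_norml; apply/andP; split; lra.
move=> fnear du dv; apply/eqP; rewrite -subr_eq0 -normr_le0.
apply/ler_addgt0Pl => e e0; rewrite addr0.
have e20 : 0 < e / 2 by rewrite divr_gt0.
have [d1 d10 H1] := second_difference_approx v fnear du e20.
have [d2 d20 H2] := second_difference_approx u fnear dv e20.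
(* Halving puts [t] strictly below both radii. *)
pose t := Num.min d1 d2 / 2.
have m0 : 0 < Num.min d1 d2 by rewrite lt_min d10.
have t0 : 0 < t by rewrite divr_gt0.
have : t < Num.min d1 d2 by rewrite /t; lra.
rewrite lt_min => /andP[t1 t2].
have {}H1 := H1 t; have {}H2 := H2 t; rewrite t0 t1 t2 /= in H1 H2.
have {}H1 := H1 isT; have {}H2 := H2 isT.
have tt0 : 0 < t ^+ 2 by rewrite exprn_gt0.
rewrite -(ler_pM2r tt0) -[X in _ * X](gtr0_norm tt0) -normrM.
(* Reordering the terms identifies the two second differences. *)
apply: close H1 _; move: H2; rewrite (addrCA (t *: v)).
by rewrite [X in X + f a - _]addrAC.
Qed.

(** * Derivatives of the squared error of an affine map *)

Lemma is_derive_mulmxr (R : realType) (n K : nat) (M : 'M[R]_(n, K)) (k : 'I_K)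
    (z : R) (a v : 'rV[R]_n) :
  is_derive a v (fun t : 'rV[R]_n => (t *m M) 0 k - z) ((v *m M) 0 k).
Proof.
(* By linearity the difference quotient is constant for [h != 0], so its limit is that constant. *)
have E : \forall h \near 0^', h^-1 *:
    (((fun t : 'rV[R]_n => (t *m M) 0 k - z) \o shift a) (h *: v)
      - ((a *m M) 0 k - z)) = (v *m M) 0 k.
  near=> h; have h0 : h != 0 by near: h; exact: nbhs_dnbhs_neq.
  rewrite /= mulmxDl -scalemxAl !mxE opprB addrA subrK addrK.
  by rewrite [_ *: _]mulrA mulVf// mul1r.
split; first exact: (is_cvg_near_cst _ E).
exact: (lim_near_cst _ E).
Unshelve. all: by end_near. Qed.

Lemma differentiable_mulmxr (R : realType) (n K : nat) (M : 'M[R]_(n, K))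
    (k : 'I_K) (z : R) (a : 'rV[R]_n) :
  differentiable (fun t : 'rV[R]_n => (t *m M) 0 k - z) a.
Proof.
apply: differentiableB => //.
have -> : (fun t : 'rV[R]_n => (t *m M) 0 k) =
    \sum_i (fun t : 'rV[R]_n => t 0 i * M i k).
  by apply/funext => t; rewrite mxE fct_sumE.
apply: differentiable_sum => i; apply: differentiableM => //.
exact: differentiable_coord.
Qed.

Section quadratic.
Context (R : realType) (n K : nat) (M : 'M[R]_(n, K)) (y : 'cV[R]_K) (c : R).

(** The MSE loss as a function of the last layer is the case where [M] is [last_layer_mx K x'] and
    [c] is [K%:R^-1]. *)
Definition squared_error (t : 'rV[R]_n) : R :=
  c * \sum_k ((t *m M) 0 k - y k 0) ^+ 2.

Let err k := fun t : 'rV[R]_n => (t *m M) 0 k - y k 0.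

(** Operations on functions replace operations on values, so that the differentiation rules
    apply. *)
Lemma squared_errorE : squared_error = c *: \sum_k err k ^+ 2.
Proof.
apply/funext => t; rewrite fctE fct_sumE; congr (_ * _).
Qed.

Lemma differentiable_squared_error a : differentiable squared_error a.
Proof.
rewrite squared_errorE; apply: differentiableZ; apply: differentiable_sum => k.
by apply: differentiableX; exact: differentiable_mulmxr.
Qed.

Lemma derive_squared_error v :
  'D_v squared_error = c *: \sum_k (2 * (v *m M) 0 k) *: err k.
Proof.
apply/funext => a; rewrite squared_errorE.
have d k : is_derive a v (err k) ((v *m M) 0 k) by exact: is_derive_mulmxr.
rewrite derive_val fctE fct_sumE; congr (_ * _); apply: eq_bigr => k _.
by rewrite fctE /= expr1 /GRing.scale /=; ring.
Qed.

Lemma differentiable_derive_squared_error v a :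
  differentiable ('D_v squared_error) a.
Proof.
rewrite derive_squared_error; apply: differentiableZ.
apply: differentiable_sum => k.
by apply: differentiableZ; exact: differentiable_mulmxr.
Qed.

Lemma derive2_squared_error u v a :
  'D_u ('D_v squared_error) a =
  2 * c * \sum_k (u *m M) 0 k * (v *m M) 0 k.
Proof.
rewrite derive_squared_error.
have d k : is_derive a u (err k) ((u *m M) 0 k) by exact: is_derive_mulmxr.
rewrite derive_val /GRing.scale /= [2 * c]mulrC -mulrA.
congr (_ * _); rewrite mulr_sumr.
by apply: eq_bigr => k _; ring.
Qed.

Lemma twice_differentiable_squared_error a : twice_differentiable squared_error a.
Proof.
split; last by move=> j; exact: differentiable_derive_squared_error.
by near=> x; exact: differentiable_squared_error.
Unshelve. all: by end_near. Qed.

Lemma hessian_squared_error a : hessian squared_error a = (2 * c) *: (M *m M^T).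
Proof.
apply/matrixP => i j; rewrite !mxE derive2_squared_error; congr (_ * _).
by apply: eq_bigr => k _; rewrite -!rowE !mxE.
Qed.

End quadratic.

(** * Largest eigenvalue of a real symmetric matrix *)

Lemma dotmxE (R : pzRingType) (n : nat) (v : 'rV[R]_n) :
  (v *m v^T) 0 0 = \sum_i v 0 i ^+ 2.
Proof. by rewrite mxE; apply: eq_bigr => i _; rewrite mxE expr2. Qed.

Lemma sumr_sqr_gt0 (R : realType) (n : nat) (v : 'rV[R]_n) :
  v != 0 -> 0 < \sum_i v 0 i ^+ 2.
Proof.
move=> v0; rewrite lt_def sumr_ge0 ?andbT => [|i _]; last exact: sqr_ge0.
apply: contraNneq v0 => /eqP; rewrite psumr_eq0 => [/allP vs|i _];
  last exact: sqr_ge0.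
apply/eqP/rowP => i; rewrite mxE; apply/eqP.
by have := vs i (mem_index_enum i); rewrite /= sqrf_eq0.
Qed.

(** With [u = v *m B] and [s] the sum of squares of [u], the form at [v + t *: u] is
    [t ^+ 2 * b u u + 2 * t * s]. If [s > 0], this is negative for suitable small negative [t]. *)
Lemma psd_isotropic_ker (R : realType) (n : nat) (B : 'M[R]_n) (v : 'rV[R]_n) :
  B^T = B -> (forall u : 'rV[R]_n, 0 <= (u *m B *m u^T) 0 0) ->
  (v *m B *m v^T) 0 0 = 0 -> v *m B = 0.
Proof.
move=> Bsym Bpos vB0.
pose b (u w : 'rV[R]_n) : R := (u *m B *m w^T) 0 0.
have bDl u1 u2 w : b (u1 + u2) w = b u1 w + b u2 w.
  by rewrite /b !mulmxDl mxE.
have bDr u w1 w2 : b u (w1 + w2) = b u w1 + b u w2.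
  by rewrite /b linearD /= !mulmxDr mxE.
have bZl t u w : b (t *: u) w = t * b u w by rewrite /b -!scalemxAl mxE.
have bZr t u w : b u (t *: w) = t * b u w.
  by rewrite /b linearZ /= -!scalemxAr mxE.
pose u := v *m B; pose s := \sum_i u 0 i ^+ 2.
have vu : b v u = s by rewrite /b dotmxE.
have uv : b u v = s.
  by rewrite /b -mulmxA -{1}Bsym -trmx_mul dotmxE.
have q0 : 0 <= b u u by exact: Bpos.
have pos t : 0 <= t ^+ 2 * b u u + 2 * t * s.
  have : 0 <= b (v + t *: u) (v + t *: u) by exact: Bpos.
  rewrite bDl !bDr !bZl !bZr vu uv [b v v]vB0 => h.
  by apply: (le_trans h); rewrite le_eqVlt; apply/orP; left; apply/eqP; ring.
apply/eqP; apply: contraT => /sumr_sqr_gt0; rewrite -/s => s_gt0.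
have q1 : 0 < b u u + 1 by lra.
(* The minimizer would be [- s / b u u]; adding 1 avoids a zero denominator and still gives a
   negative value. *)
have := pos (- s / (b u u + 1)).
have -> : (- s / (b u u + 1)) ^+ 2 * b u u + 2 * (- s / (b u u + 1)) * s =
   - ((s / (b u u + 1)) ^+ 2 * (b u u + 2)) by field; exact: lt0r_neq0.
rewrite oppr_ge0 leNgt mulr_gt0 ?exprn_gt0 ?divr_gt0//; lra.
Qed.

Lemma compact_sphere (R : realType) (n : nat) :
  compact [set v : 'rV[R]_n | \sum_i v 0 i ^+ 2 = 1].
Proof.
apply: bounded_closed_compact.
  (* Boundedness concerns the sup norm: each squared coordinate is at most the sum of squares, which
     is 1. *)
  exists 1; split => // M M1 v /= v1; apply: le_trans (ltW M1).
  rewrite [`|v|]mx_normrE; apply: bigmax_le => // -[i j] _ /=.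
  rewrite ord1 -(ler_pXn2r (_ : 0 < 2)%N) ?nnegrE// expr1n real_normK ?num_real//.
  by rewrite -v1 (bigD1 j)//= lerDl sumr_ge0// => k _; exact: sqr_ge0.
apply: (@preimage_closed _ _ (fun v : 'rV[R]_n => \sum_i v 0 i ^+ 2) [set 1]).
  move=> v _; apply: (@differentiable_continuous R 'rV[R]_n R).
  have -> : (fun v : 'rV[R]_n => \sum_i v 0 i ^+ 2) =
      \sum_i (fun v : 'rV[R]_n => v 0 i) ^+ 2.
    by apply/funext => u; rewrite fct_sumE.
  apply: differentiable_sum => i.
  by apply: differentiableX; exact: differentiable_coord.
exact: closed_eq.
Qed.

(** At a maximizer [v] of the quadratic form [q] on the unit sphere, the matrix [(q v)%:M - A] is
    positive semidefinite and isotropic at [v], so it kills [v]: the maximum [q v] is an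
    eigenvalue. *)
Lemma symmetric_largest_eigenvalue (R : realType) (n : nat) (A : 'M[R]_n)
    (i0 : 'I_n) :
  A^T = A -> exists2 l, largest_eigenvalue A l & A i0 i0 <= l.
Proof.
move=> Asym; set S := [set v : 'rV[R]_n | \sum_i v 0 i ^+ 2 = 1].
pose q (v : 'rV[R]_n) : R := (v *m A *m v^T) 0 0.
have delta1 : S (delta_mx 0 i0).
  rewrite /S /= (bigD1 i0)//= big1 ?addr0 ?mxE ?eqxx ?expr1n// => j ji.
  by rewrite mxE (negbTE ji) andbF expr0n.
have [||v] := @compact_EVT_max _ R q S _ (@compact_sphere R n).
- by exists (delta_mx 0 i0).
- apply: continuous_subspaceT => w.
  apply: (@differentiable_continuous R 'rV[R]_n R).
  (* The dummy [- 0] gives the first factor the shape of [differentiable_mulmxr]. *)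
  have -> : q = \sum_j (fun v : 'rV[R]_n => ((v *m A) 0 j - 0) * v 0 j).
    apply/funext => u; rewrite /q mxE fct_sumE; apply: eq_bigr => j _.
    by rewrite [u^T _ _]mxE subr0.
  apply: differentiable_sum => j; apply: differentiableM.
    exact: differentiable_mulmxr.
  exact: differentiable_coord.
rewrite inE => v1 vmax; exists (q v); last first.
  have := vmax (delta_mx 0 i0); rewrite inE => /(_ delta1).
  by rewrite {1}/q -rowE mxE (bigD1 i0)//= big1 => [|j ji];
    rewrite !mxE ?eqxx ?mulr1 ?addr0// (negbTE ji) mulr0.
(* Homogeneity of degree 2 carries the maximality of [v] from the sphere to all vectors. *)
have qle u : q u <= q v * \sum_i u 0 i ^+ 2.
  have [->|u0] := eqVneq u 0.
    by rewrite /q !mul0mx mxE big1 ?mulr0// => i _; rewrite mxE expr0n.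
  set s := \sum_i _.
  have s0 : 0 < s by exact: sumr_sqr_gt0.
  have r0 : 0 < Num.sqrt s by rewrite sqrtr_gt0.
  have rr : Num.sqrt s ^+ 2 = s by rewrite sqr_sqrtr// ltW.
  have : S ((Num.sqrt s)^-1 *: u).
    transitivity (s^-1 * \sum_i u 0 i ^+ 2); last exact/mulVf/lt0r_neq0.
    rewrite mulr_sumr.
    by apply: eq_bigr => i _; rewrite mxE exprMn exprVn rr.
  rewrite -inE => /vmax; rewrite {1}/q -!scalemxAl linearZ /=.
  rewrite -scalemxAr scalerA mxE -invfM -expr2 rr.
  by rewrite ler_pdivrMl// mulrC.
split; last first.
  (* On an eigenvector [u] for [m], [q u] is [m] times the sum of squares of [u], so [qle] gives
     [m <= q v]. *)
  move=> m /eigenvalueP[u uA u0].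
  have := qle u; rewrite /q uA -scalemxAl mxE dotmxE.
  by rewrite ler_pM2r//; exact: sumr_sqr_gt0.
apply/eigenvalueP; exists v; last first.
  apply/eqP => v0; move: v1; rewrite /S /= v0 big1 => [/esym/eqP|i _].
    by rewrite oner_eq0.
  by rewrite mxE expr0n.
apply/eqP; rewrite eq_sym -subr_eq0 -mul_mx_scalar -mulmxBr; apply/eqP.
have qB u : (u *m ((q v)%:M - A) *m u^T) 0 0 = q v * (\sum_i u 0 i ^+ 2) - q u.
  by rewrite mulmxBr mulmxBl mul_mx_scalar -scalemxAl mxE [X in X + _]mxE
    [X in _ + X]mxE dotmxE.
apply: psd_isotropic_ker => [|u|].
- by rewrite linearB /= tr_scalar_mx Asym.
- by rewrite qB subr_ge0.
- by rewrite qB v1 mulr1 subrr.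
Qed.

(** * Vectorization and the Kronecker product *)

Lemma index_allpairs (T1 T2 : eqType) (s1 : seq T1) (s2 : seq T2) (x1 : T1)
    (x2 : T2) :
  x1 \in s1 -> x2 \in s2 ->
  index (x1, x2) [seq (y1, y2) | y1 <- s1, y2 <- s2] =
  (index x1 s1 * size s2 + index x2 s2)%N.
Proof.
move=> + x2s; elim: s1 => //= y s1 IH; rewrite inE index_cat eq_sym.
have [-> _|ne /= x1s] := eqVneq x1 y.
  have pair_inj : injective (pair y : T2 -> T1 * T2) by move=> a b [].
  by rewrite mem_map// x2s index_map// mul0n.
rewrite ifN; first by rewrite size_map IH// mulSn addnA.
by apply/negP => /mapP[z _ [e _]]; rewrite e eqxx in ne.
Qed.

(** Both number the entries row by row, sending [(i, j)] to [i * n + j]. This reconciles [mxvec]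
    with the index convention of [tensmx]. *)
Lemma mxvec_indexE (m n : nat) (i : 'I_m) (j : 'I_n) :
  mxvec_index i j = mxtens_index (i, j).
Proof.
apply: val_inj => /=.
have -> : enum_rank (i, j) = index (i, j) (enum {: 'I_m * 'I_n}) :> nat.
  rewrite -{2}(nth_enum_rank (i, j) (i, j)) index_uniq ?enum_uniq//.
  by rewrite -cardE; exact: ltn_ord.
rewrite enumT unlock /prod_enum index_allpairs ?mem_enum//.
by rewrite !index_enum_ord size_enum_ord.
Qed.

(* The rows of this matrix are the images of the basis vectors of the space of
   pairs (W, b) under the linear map sending (W, b) to W z + b. *)
Definition last_layer_mx (R : realType) (K p : nat) (z : 'cV[R]_p) :
    'M[R]_(K * p + K, K) :=
  col_mx (castmx (erefl, muln1 K) (tensmx 1%:M z)) 1%:M.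

Lemma mulmx_last_layer (R : realType) (K p : nat) (W : 'M[R]_(K, p))
    (b : 'cV[R]_K) (z : 'cV[R]_p) :
  row_mx (mxvec W) b^T *m last_layer_mx K z = (W *m z + b)^T.
Proof.
rewrite /last_layer_mx mul_row_col mulmx1 linearD /=; congr (_ + _).
apply/rowP => k; rewrite !mxE (reindex _ (curry_mxvec_bij _ _)) /=.
transitivity (\sum_i \sum_j W i j * (1%:M i k * z j 0)).
  rewrite pair_bigA /=; apply: eq_bigr => -[i j] _ /=.
  rewrite mxvecE mxvec_indexE castmxE /= cast_ord_id.
  (* The [K * 1] columns of the Kronecker product are indexed by pairs whose second component is
     0. *)
  have -> : cast_ord (esym (muln1 K)) k = mxtens_index (k, 0).
    by apply: val_inj; rewrite /= muln1 addn0.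
  by rewrite tensmxE.
rewrite exchange_big /=; apply: eq_bigr => j _.
rewrite (bigD1 k)//= big1 ?addr0 => [|i ik]; rewrite !mxE ?eqxx ?mul1r//.
by rewrite (negbTE ik) mul0r mulr0.
Qed.

(** The mixed-product rule multiplies the Kronecker factors separately and gives the upper left
    block; every other block has an identity factor. *)
Lemma last_layer_mx_sqr (R : realType) (K p : nat) (z : 'cV[R]_p) :
  last_layer_mx K z *m (last_layer_mx K z)^T =
  block_mx (tensmx 1%:M (z *m z^T)) (castmx (erefl, muln1 K) (tensmx 1%:M z))
    (castmx (erefl, muln1 K) (tensmx 1%:M z))^T 1%:M.
Proof.
rewrite tr_col_mx mul_col_row trmx1 !mulmx1 mul1mx; congr block_mx.
rewrite trmx_cast /=.
(* Generalizing the target size [K] to a free [q] allows elimination of the equality behind the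
   casts. *)
have castK q (e : (K * 1 = q)%N) (A B : 'M[R]_(K * p, K * 1)) :
    castmx (erefl, e) A *m castmx (e, erefl) B^T = A *m B^T.
  by case: q / e.
by rewrite castK trmx_tens trmx1 tensmx_mul mulmx1.
Qed.

(** * From the full Hessian to the last layer *)

(** Moving along [row_mx 0 v] fixes the left block [l], so the two difference quotients are the same
    function of [h]. *)
Lemma derive_row_mx (R : realType) (m n : nat) (F : 'rV[R]_(m + n) -> R)
    (l : 'rV[R]_m) (v t : 'rV[R]_n) :
  'D_(row_mx 0 v) F (row_mx l t) = 'D_v (fun s => F (row_mx l s)) t.
Proof.
have E : (fun h : R => h^-1 *: ((F \o shift (row_mx l t)) (h *: row_mx 0 v)
      - F (row_mx l t))) =
    (fun h : R => h^-1 *: (((fun s => F (row_mx l s)) \o shift t) (h *: v)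
      - F (row_mx l t))).
  by apply/funext => h /=; rewrite scale_row_mx scaler0 add_row_mx add0r.
by rewrite /derive E.
Qed.

Lemma delta_mx_rshift (R : pzRingType) (m n : nat) (j : 'I_n) :
  delta_mx 0 (rshift m j) = row_mx 0 (delta_mx 0 j) :> 'rV[R]_(m + n).
Proof.
apply/rowP => i; rewrite !mxE; case: split_ordP => k ->; rewrite !mxE.
  by rewrite eq_lrshift andbF.
by rewrite eq_rshift.
Qed.

Lemma hessian_rshift (R : realType) (m K p : nat)
    (F : 'rV[R]_(m + (K * p + K)) -> R) (w : 'rV[R]_(m + (K * p + K)))
    (i j : 'I_(K * p + K)) :
  hessian F w (rshift m i) (rshift m j) = hessian_Wb F w i j.
Proof.
rewrite !mxE !delta_mx_rshift -[in LHS](hsubmxK w) derive_row_mx.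
have E : (fun t => 'D_(row_mx 0 (delta_mx 0 j)) F (row_mx (lsubmx w) t)) =
    'D_(delta_mx 0 j) (last_layer F w).
  by apply/funext => t; rewrite derive_row_mx.
by rewrite -E.
Qed.

Lemma tr_hessian (R : realType) (n : nat) (F : 'rV[R]_n -> R) (a : 'rV[R]_n) :
  twice_differentiable F a -> (hessian F a)^T = hessian F a.
Proof.
by move=> [dF d2F]; apply/matrixP => i j; rewrite !mxE; exact: derive_comm.
Qed.

Lemma last_layer_mse (R : realType) (m K p : nat)
    (g : 'rV[R]_(m + (K * p + K)) -> 'cV[R]_K) (yhat : 'cV[R]_K)
    (prev : 'rV[R]_m -> 'cV[R]_p)
    (gE : forall w' (W : 'M[R]_(K, p)) b, g (params w' W b) = W *m prev w' + b)
    (w : 'rV[R]_(m + (K * p + K))) :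
  last_layer (fun w => mse_loss (g w) yhat) w =
  squared_error (last_layer_mx K (prev (lsubmx w))) yhat K%:R^-1.
Proof.
apply/funext => t; rewrite /last_layer /mse_loss /squared_error.
(* Every [t] has the form [row_mx (mxvec W) b^T]; exhibiting it lets [gE] apply. *)
rewrite -[t]hsubmxK -[lsubmx t]vec_mxK -[rsubmx t]trmxK gE mulmx_last_layer.
rewrite /euclidean_norm sqr_sqrtr ?sumr_ge0// => [|i _]; last exact: sqr_ge0.
by congr (_ * _); apply: eq_bigr => k _; rewrite !mxE.
Qed.

Lemma mxtrace_tens1 (R : comPzRingType) (K p : nat) (A : 'M[R]_p) :
  \tr (tensmx (1%:M : 'M[R]_K) A) = K%:R * \tr A.
Proof.
have tens_bij : bijective (@mxtens_index K p).
  by exists (@mxtens_unindex K p); [exact: mxtens_indexK|exact: mxtens_unindexK].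
rewrite /mxtrace (reindex _ (onW_bij _ tens_bij)) /=.
transitivity (\sum_(i < K) \sum_(j < p) A j j).
  rewrite pair_bigA /=; apply: eq_bigr => -[i j] _ /=.
  by rewrite tensmxE mxE eqxx mul1r.
by rewrite sumr_const card_ord mulr_natl.
Qed.

Theorem lemmaB23 (R : realType) (X : Type) (m K p : nat) (K_gt0 : (0 < K)%N)
    (net : X -> 'rV[R]_(m + (K * p + K)) -> 'cV[R]_K)
    (x : X) (yhat : 'cV[R]_K) (prev : 'rV[R]_m -> 'cV[R]_p)
    (net_last_linear : forall (w' : 'rV[R]_m) (W : 'M[R]_(K, p)) (b : 'cV[R]_K),
        net x (params w' W b) = W *m prev w' + b)
    (w' : 'rV[R]_m) (W : 'M[R]_(K, p)) (b : 'cV[R]_K) :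
  let f := fun w => mse_loss (net x w) yhat in
  let w := params w' W b in
  let x' := prev w' in
  [/\ twice_differentiable (last_layer f w) (rsubmx w),
      [/\ hessian_W f w = (2 / K%:R) *: tensmx 1%:M (x' *m x'^T),
          hessian_b f w = (2 / K%:R) *: 1%:M
        & hessian_W_b f w =
            (2 / K%:R) *: castmx (erefl, muln1 K) (tensmx 1%:M x')],
      \tr (hessian_Wb f w) = 2 * (euclidean_norm x' ^+ 2 + 1)
    & twice_differentiable f w ->
        exists2 l : R, largest_eigenvalue (hessian f w) l & 2 / K%:R <= l].
Proof.
move=> f w x'.
have lE : last_layer f w = squared_error (last_layer_mx K x') yhat K%:R^-1.
  by rewrite (last_layer_mse yhat net_last_linear) row_mxKl.
have HE : hessian_Wb f w = (2 / K%:R) *: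
    block_mx (tensmx 1%:M (x' *m x'^T)) (castmx (erefl, muln1 K) (tensmx 1%:M x'))
      (castmx (erefl, muln1 K) (tensmx 1%:M x'))^T 1%:M.
  by rewrite /hessian_Wb lE hessian_squared_error last_layer_mx_sqr.
have HbE : hessian_b f w = (2 / K%:R) *: 1%:M.
  by rewrite /hessian_b HE scale_block_mx block_mxKdr.
have K0 : K%:R != 0 :> R by rewrite pnatr_eq0 -lt0n.
split.
- by rewrite lE; exact: twice_differentiable_squared_error.
- split=> //; first by rewrite /hessian_W HE scale_block_mx block_mxKul.
  by rewrite /hessian_W_b HE scale_block_mx block_mxKur.
(* Cyclicity of the trace replaces [x' *m x'^T] by a 1 by 1 matrix, whose entry is the squared norm
   of [x']. *)
- rewrite HE mxtraceZ mxtrace_block mxtrace_tens1 mxtrace1 mxtrace_mulC.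
  rewrite trace_mx11 mxE /euclidean_norm sqr_sqrtr; last first.
    by apply: sumr_ge0 => i _; exact: sqr_ge0.
  under eq_bigr => i _ do rewrite mxE -expr2.
  by field.
- move=> /tr_hessian sym.
  (* The position of the first bias coordinate, which exists because [K > 0]. *)
  pose k := rshift m (rshift (K * p) (Ordinal K_gt0)).
  have [l lmax lge] := symmetric_largest_eigenvalue k sym.
  exists l => //; apply: le_trans lge; rewrite hessian_rshift.
  have /matrixP/(_ (Ordinal K_gt0) (Ordinal K_gt0)) := HbE.
  by rewrite /hessian_b !mxE eqxx mulr1 => ->.
Qed.
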